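(* For an integer $n\ge 0$ let $$D_n(z)=\prod_{r=1}^n\left(z^2+4\sin^2\left(\frac{\pi r}{2n+1}\right)z+1\right)=\sum_{k=0}^{2n}a_k^{(n)}z^k.$$ Then $D_n(z)$ is symmetric, and for $0\le k\le n$ its coefficients satisfy $$a_k^{(n)}=B_k^{(n)}+B_{k-1}^{(n-1)},\qquad\text{where}\qquad B_k^{(n)}=\sum_{j=0}^{\lfloor k/2\rfloor}\binom{k-j}{j}2^{k-2j}\binom{n-j}{k-2j}.$$ The remaining coefficients, for $n<k\le 2n$, are given by $a_k^{(n)}=a_{2n-k}^{(n)}$.
   Context: Empty products equal $1$ (so $D_0=1$) and empty sums equal $0$ (so $B_{-1}^{(n-1)}=0$). ''Symmetric'' means $a_k^{(n)}=a_{2n-k}^{(n)}$ for all $0\le k\le 2n$. *)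

(* Defs.v *)
From mathcomp Require Import all_boot all_order all_algebra.
From mathcomp Require Import reals trigo.

Set Implicit Arguments.
Unset Strict Implicit.
Unset Printing Implicit Defensive.

Import Order.TTheory GRing.Theory Num.Theory.
Local Open Scope ring_scope.

(* D_n as a formal polynomial in z, so that a_k^(n) is the coefficient (D R n)`_k. *)
Definition D (R : realType) (n : nat) : {poly R} :=
  \prod_(1 <= r < n.+1)
    ('X^2 + (4 * sin (pi * r%:R / (2 * n + 1)%:R) ^+ 2) *: 'X + 1).

Definition a (R : realType) (n k : nat) : R := (D R n)`_k.

(* The truncated subtractions are exact for j <= k/2 and k <= n, the only range used. *)
Definition B (n k : nat) : nat :=
  (\sum_(0 <= j < (k %/ 2).+1)
     'C(k - j, j) * 2 ^ (k - 2 * j) * 'C(n - j, k - 2 * j))%N.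

(* B_{k-1}^(n-1), where B_{-1}^(n-1) is an empty sum (including when n = 0). *)
Definition B_pred (n k : nat) : nat :=
  if k is k'.+1 then B n.-1 k' else 0%N.

(* Main.v *)
Require Import Defs.
From mathcomp Require Import all_boot all_order all_algebra.
From mathcomp Require Import reals trigo.
From mathcomp Require Import ring lra zify.

Set Implicit Arguments.
Unset Strict Implicit.
Unset Printing Implicit Defensive.

Import Order.TTheory GRing.Theory Num.Theory.
Local Open Scope ring_scope.

(** Put y = z + 2 + 1/z.  Since 4 sin^2 t = 2 - 2 cos 2t, every factor of D_n is
z (y - 2 cos (2 pi r / (2n+1))), so D_n (z) = z^n W_n (y), where W_n is the monic
polynomial of degree n with roots 2 cos (2 pi r / (2n+1)), 1 <= r <= n.  This W_n
is the Chebyshev polynomial of the fourth kind [chebW]: the sine addition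
formula turns its recurrence W_(n+2) = y W_(n+1) - W_n into
W_n (2 cos 2t) sin t = sin ((2n+1) t), which gives the roots ([chebW_prod]).

Multiplying the recurrence by z^(n+2), the polynomials z^n W_n (y) satisfy
F_(n+2) = (1+z)^2 F_(n+1) - z^2 F_n.  The solution of this recurrence with
F_(-1) = 0 and F_0 = 1 is the second-kind polynomial U_n homogenized in the same
way, and its expansion is the double sum
  sum_(j, m) 'C(j+m, j) 2^m 'C(n-j, m) z^(2j+m)    ([homU], [homU_rec]),
whose coefficient at z^k is B_k^(n).  Finally W_n = U_n + U_(n-1) becomes
D_n = homU_n + z homU_(n-1) ([D_eq_homW]), the asserted formula.  The double sum
is the expansion of the generating function
  1 / ((1-q) (1 - z^2 q) - 2 z q) = 1 / (1 - (1+z)^2 q + z^2 q^2)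
in powers of z^2 q and 2 z q / (1-q).

The symmetry holds because z^(2n) D_n (1/z) = D_n (z), factor by factor. *)

(** * The double sum and its recurrence *)

(** The part of the double sum with fixed j, divided by z^(2j), where N stands
for n - j. *)
Definition columnU (R : nzRingType) (N j : nat) : {poly R} :=
  \poly_(m < N.+1) ('C(j + m, j) * 2 ^ m * 'C(N, m))%:R.

Definition homU (R : nzRingType) (n : nat) : {poly R} :=
  \sum_(0 <= j < n.+1) 'X^(2 * j) * columnU R (n - j) j.

Lemma coef_columnU (R : nzRingType) N j m :
  (columnU R N j)`_m = ('C(j + m, j) * 2 ^ m * 'C(N, m))%:R.
Proof.
rewrite coef_poly ltnS; case: leqP => // ltNm.
by rewrite (bin_small ltNm) muln0.
Qed.

Lemma columnU_0 (R : nzRingType) j : columnU R 0 j = 1.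
Proof.
apply/polyP => -[|m]; rewrite coef_columnU coef1; last by rewrite muln0.
by rewrite addn0 binn.
Qed.

(** Here columnU N 0 is (1 + 2z)^N, so its first difference is 2z times itself. *)
Lemma columnU_step0 (R : comNzRingType) N :
  columnU R N.+1 0 - columnU R N 0 = 'X * columnU R N 0 *+ 2.
Proof.
apply/polyP => -[|m]; rewrite coefB !coefMn coefXM !coef_columnU /=.
  by rewrite !bin0 subrr ?mul0rn.
rewrite !bin0 -natrB ?leq_mul ?leq_bin2l // -mulrnA.
congr (_%:R); rewrite binS expnS; lia.
Qed.

(** Coefficientwise this is Pascal's rule twice, once in each of the binomials
'C(j+m, j) and 'C(N, m).  The recurrence of [homU] is the sum of these identities
over j. *)
Lemma columnU_stepS (R : comNzRingType) N j :
  columnU R N.+1 j.+1 - columnU R N j.+1 =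
  'X * columnU R N j.+1 *+ 2 + (columnU R N.+1 j - columnU R N j).
Proof.
apply/polyP => -[|m]; rewrite !(coefB, coefD, coefMn, coefXM, coef_columnU) /=.
  by rewrite !addn0 !binn !bin0 !subrr ?mul0rn ?addr0.
have -> : 'C(j.+1 + m.+1, j.+1) = ('C(j.+1 + m, j.+1) + 'C(j + m.+1, j))%N.
  by rewrite addSn binS addnS.
rewrite binS expnS !(natrM, natrD).
ring.
Qed.

(** The lone power of z is the column j = n+1, which first appears in rank n+1. *)
Lemma homU_diff (R : comNzRingType) n :
  homU R n.+1 - homU R n =
  'X^(2 * n.+1)
  + \sum_(0 <= j < n.+1)
      'X^(2 * j) * (columnU R (n - j).+1 j - columnU R (n - j) j).
Proof.
rewrite /homU big_nat_recr //= subnn columnU_0 mulr1 addrAC addrC; congr (_ + _).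
rewrite -sumrB; apply: eq_big_nat => j /andP[_ lejn].
by rewrite -mulrBr subSn.
Qed.

(** In the form of a relation between first differences, both sides match column
by column through [columnU_stepS], with the last term shifted from j to j+1. *)
Lemma homU_rec (R : comNzRingType) n :
  homU R n.+2 = (1 + 'X) ^+ 2 * homU R n.+1 - 'X^2 * homU R n.
Proof.
suff H : homU R n.+2 - homU R n.+1 =
    'X * homU R n.+1 *+ 2 + 'X^2 * (homU R n.+1 - homU R n).
  by rewrite -[LHS](subrK (homU R n.+1)) H; ring.
rewrite !homU_diff mulrDr -exprD -mulnS addrCA; congr (_ + _).
rewrite {1}/homU big_nat_recl //= [in RHS]big_nat_recl //= muln0 expr0 !mul1r.
rewrite !subn0 columnU_step0 mulrDr mulrnDl -[in RHS]addrA; congr (_ + _).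
rewrite !mulr_sumr -sumrMnl -big_split /=; apply: eq_big_nat => j _.
rewrite subSS columnU_stepS mulnS exprD; ring.
Qed.

(** The bound on k keeps j <= n for all j <= k/2, so that the truncated n - j in B
agrees with the range of the double sum. *)
Lemma coef_homU (R : comNzRingType) n k :
  (k <= 2 * n)%N -> (homU R n)`_k = (B n k)%:R.
Proof.
move=> le_k; rewrite /homU /B coef_sum natr_sum.
have le_h : ((k %/ 2).+1 <= n.+1)%N by lia.
rewrite (big_nat_widen _ _ _ _ _ le_h) [RHS]big_mkcond /=.
apply: eq_big_nat => j _; rewrite coefXnM coef_columnU.
case: ltnP => h; case: ltnP => h' //; try lia.
by congr (('C(_, _) * _ * _)%:R); lia.
Qed.

(** The homogenized form of W_n = U_n + U_(n-1), where U_(-1) = 0. *)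
Definition homW (R : nzRingType) (n : nat) : {poly R} :=
  homU R n + 'X * (if n is m.+1 then homU R m else 0).

Lemma homU0 (R : nzRingType) : homU R 0 = 1.
Proof. by rewrite /homU big_nat1 columnU_0 mulr1 expr0. Qed.

Lemma homU1 (R : comNzRingType) : homU R 1 = (1 + 'X) ^+ 2.
Proof.
rewrite -[LHS](subrK (homU R 0)) homU_diff big_nat1 columnU_step0 columnU_0 homU0.
ring.
Qed.

Lemma homW_rec (R : comNzRingType) n :
  homW R n.+2 = (1 + 'X) ^+ 2 * homW R n.+1 - 'X^2 * homW R n.
Proof.
case: n => [|n]; rewrite /homW !homU_rec ?homU1 ?homU0; ring.
Qed.

Lemma coef_homW (R : comNzRingType) n k :
  (k <= n)%N -> (homW R n)`_k = (B n k + B_pred n k)%:R.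
Proof.
move=> le_kn; rewrite coefD coefXM coef_homU ?natrD; last by lia.
by case: k le_kn => //= k; case: n => // n lt_kn; rewrite coef_homU //; lia.
Qed.

(** * Chebyshev polynomials of the fourth kind *)

(** Normalized to be monic, in the variable y = 2 cos. *)
Fixpoint chebW (R : nzRingType) (n : nat) : {poly R} :=
  match n with
  | 0 => 1
  | 1 => 'X + 1
  | (m.+1 as p).+1 => 'X * chebW R p - chebW R m
  end.

Lemma chebW_rec (R : nzRingType) n :
  chebW R n.+2 = 'X * chebW R n.+1 - chebW R n.
Proof. by []. Qed.

Lemma nat_ind2 (A : nat -> Prop) :
  A 0%N -> A 1%N -> (forall n, A n -> A n.+1 -> A n.+2) -> forall n, A n.
Proof.
move=> A0 A1 AS n; suff [] : A n /\ A n.+1 by [].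
by elim: n => [|n [An An1]]; split=> //; apply: AS.
Qed.

Lemma chebW_monic_size (R : nzRingType) n :
  chebW R n \is monic /\ size (chebW R n) = n.+1.
Proof.
elim/nat_ind2: n => [||n [_ s0] [m1 s1]] /=.
- by rewrite monic1 size_poly1.
- by rewrite -polyC1 monicXaddC size_XaddC.
have s2 : size ('X * chebW R n.+1) = n.+3.
  by rewrite -commr_polyX size_mulX ?s1 // monic_neq0.
have lt_s : (size (- chebW R n) < size ('X * chebW R n.+1)%R)%N.
  by rewrite size_polyN s2 s0.
rewrite size_polyDl // s2; split=> //.
by rewrite monicE lead_coefDl // -monicE monicMl ?monicX.
Qed.

Lemma horner_homW (F : fieldType) n (x : F) : x != 0 ->
  (homW F n).[x] = x ^+ n * (chebW F n).[(1 + x) ^+ 2 / x].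
Proof.
move=> x0; elim/nat_ind2: n => [||n IH0 IH1].
- by rewrite /homW homU0 /= mulr0 addr0 !hornerE.
- by rewrite /homW homU1 homU0 /= !hornerE; field.
have xy : x * ((1 + x) ^+ 2 / x) = (1 + x) ^+ 2 by rewrite mulrC divfK.
have lin : (1 + 'X : {poly F}).[x] = 1 + x by rewrite !hornerE.
rewrite homW_rec chebW_rec 2!hornerD 2!hornerN !hornerM !hornerX lin IH0 IH1.
by move: (_ / x) xy => y; rewrite -expr2 => <-; rewrite !exprS; ring.
Qed.

(** * Trigonometric roots *)

(** The recurrence of [chebW] is that of sin ((2n+1) t) in n, which comes from
sin (u + v) + sin (u - v) = 2 cos v sin u with v = 2t. *)
Lemma chebW_cos (R : realType) n (t : R) :
  (chebW R n).[2 * cos (t *+ 2)] * sin t = sin (t *+ (2 * n).+1).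
Proof.
have H (u v : R) : sin (u + v) + sin (u - v) = 2 * cos v * sin u.
  by rewrite sinD sinB; ring.
elim/nat_ind2: n => [||n IH0 IH1].
- by rewrite hornerC mul1r.
- have := H t (t *+ 2); have -> : t - t *+ 2 = - t by ring.
  rewrite sinN -mulrS => e.
  by rewrite [chebW R 1]/= hornerD hornerX hornerC [LHS]mulrDl mul1r -e subrK.
have := H (t *+ (2 * n.+1).+1) (t *+ 2); rewrite -mulrnDr.
have -> : t *+ (2 * n.+1).+1 - t *+ 2 = t *+ (2 * n).+1.
  by rewrite mulnS -addSn addSn addnC -addSn mulrnDr addrK.
have -> : ((2 * n.+1).+1 + 2 = (2 * n.+2).+1)%N by lia.
move=> e; rewrite chebW_rec hornerD hornerN hornerM hornerX mulrBl IH0 -mulrA IH1.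
by rewrite -e addrK.
Qed.

Definition node (R : realType) (n r : nat) : R := pi * r%:R / (2 * n + 1)%:R.

Lemma node_bound (R : realType) n r :
  (0 < r <= n)%N -> 0 < node R n r /\ node R n r *+ 2 < pi.
Proof.
move=> /andP[r0 rn]; have pi0 := pi_gt0 R.
have d0 : 0 < (2 * n + 1)%:R :> R by rewrite ltr0n; lia.
split; first by rewrite /node divr_gt0 // mulr_gt0 // ltr0n.
rewrite /node -mulrnAl ltr_pdivrMr // -mulrnAr ltr_pM2l // -mulrnA ltr_nat.
lia.
Qed.

Lemma node_inj (R : realType) n : injective (node R n).
Proof.
have pi0 := pi_gt0 R.
have d0 : 0 < (2 * n + 1)%:R :> R by rewrite ltr0n; lia.
move=> r s /(divIf (lt0r_neq0 d0)) /(mulfI (lt0r_neq0 pi0)).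
by move/eqP; rewrite eqr_nat => /eqP.
Qed.

(** At a node t we have sin ((2n+1) t) = sin (pi r) = 0 and sin t <> 0, so
2 cos 2t is a root; the n angles 2t are distinct in ]0, pi[, where cos is
injective, so these are all the roots. *)
Lemma chebW_prod (R : realType) n :
  chebW R n = \prod_(1 <= r < n.+1) ('X - (2 * cos (node R n r *+ 2))%:P).
Proof.
have [mW sW] := chebW_monic_size R n.
pose rs := [seq 2 * cos (node R n r *+ 2) | r <- index_iota 1 n.+1].
have in_rs r : r \in index_iota 1 n.+1 -> (0 < r <= n)%N.
  by rewrite mem_index_iota ltnS.
rewrite (@all_roots_prod_XsubC _ (chebW R n) rs).
- by rewrite (monicP mW) scale1r big_map.
- by rewrite size_map size_iota sW subn1.
- apply/allP => _ /mapP[r /in_rs hr ->].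
  have [t0 t1] := node_bound R hr.
  have st : sin (node R n r) != 0 by rewrite gt_eqF // sin_gt0_pi // t0; lra.
  apply/eqP/(mulIf st); rewrite mul0r chebW_cos.
  have -> : node R n r *+ (2 * n).+1 = pi *+ r.
    rewrite -[LHS]mulr_natr /node -[(2 * n).+1]addn1 divfK ?mulr_natr //.
    by rewrite pnatr_eq0; lia.
  by elim: r {hr t0 t1 st} => [|r IHr]; rewrite ?sin0 // mulrSr sinDpi IHr oppr0.
- rewrite uniq_rootsE map_inj_in_uniq ?iota_uniq // => r s /in_rs hr /in_rs hs.
  have [t0 t1] := node_bound R hr; have [u0 u1] := node_bound R hs.
  have two0 : 2 != 0 :> R by rewrite pnatr_eq0.
  move/(mulfI two0)/cos_inj => H.
  apply: (@node_inj R n); apply: (mulIf two0); rewrite !mulr_natr.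
  by apply: H; rewrite in_itv /=; lra.
Qed.

(** * The polynomial D and its symmetry *)

Lemma horner_D (R : realType) n x : (D R n).[x] =
  \prod_(1 <= r < n.+1) (x ^+ 2 + 4 * sin (node R n r) ^+ 2 * x + 1).
Proof. by rewrite /D horner_prod; apply: eq_bigr => r _; rewrite !hornerE. Qed.

Lemma horner_D_chebW (R : realType) n x : x != 0 ->
  (D R n).[x] = x ^+ n * (chebW R n).[(1 + x) ^+ 2 / x].
Proof.
move=> x0; rewrite horner_D chebW_prod horner_prod.
have -> : x ^+ n = \prod_(1 <= r < n.+1) x by rewrite prodr_const_nat subn1.
rewrite -big_split; apply: eq_bigr => r _ /=.
have := cos2Dsin2 (node R n r); rewrite mulr2n cosD hornerXsubC => H.
(* Both sides become polynomials in sin of the node. *)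
have -> : cos (node R n r) * cos (node R n r) = 1 - sin (node R n r) ^+ 2.
  by rewrite -H; ring.
by field.
Qed.

Lemma horner_D_inv (R : realType) n x :
  x != 0 -> x ^+ (2 * n) * (D R n).[x^-1] = (D R n).[x].
Proof.
move=> x0; rewrite !horner_D.
have -> : x ^+ (2 * n) = \prod_(1 <= r < n.+1) x ^+ 2.
  by rewrite prodr_const_nat subn1 exprM.
by rewrite -big_split; apply: eq_bigr => r _ /=; field.
Qed.

Lemma size_prod_quadratic (R : nzRingType) (c : nat -> R) m :
  (size (\prod_(1 <= r < m.+1) ('X^2 + c r *: 'X + 1))%R <= (2 * m).+1)%N.
Proof.
elim: m => [|m IHm]; first by rewrite big_nil size_poly1.
rewrite big_nat_recr //=; apply: leq_trans (size_polyMleq _ _) _.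
have : (size ('X^2 + c m.+1 *: 'X + 1)%R <= 3)%N.
  rewrite (leq_trans (size_polyD _ _)) // geq_max size_poly1 andbT.
  rewrite (leq_trans (size_polyD _ _)) // geq_max size_polyXn /=.
  by rewrite (leq_trans (size_scale_leq _ _)) // size_polyX.
by move: IHm; do 2!move: (size _) => ?; lia.
Qed.

Lemma size_D (R : realType) n : (size (D R n) <= (2 * n).+1)%N.
Proof. exact: size_prod_quadratic. Qed.

(** Leaving out 0 allows substitutions such as y = (1 + x)^2 / x and x -> 1/x to
prove identities of polynomials; infinitely many points remain. *)
Lemma poly_eq_off0 (R : numDomainType) (p q : {poly R}) :
  (forall x, x != 0 -> p.[x] = q.[x]) -> p = q.
Proof.
move=> pq; apply/eqP; rewrite -subr_eq0; apply/negP => /negP nz.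
(* More nonzero points than the degree of p - q allows as roots. *)
pose rs : seq R := [seq k.+1%:R | k <- iota 0 (size (p - q))].
have: (size rs < size (p - q)%R)%N.
  apply: max_poly_roots => //.
    apply/allP => _ /mapP[k _ ->].
    by rewrite rootE !hornerE pq ?subrr // pnatr_eq0.
  rewrite map_inj_uniq ?iota_uniq // => i j /eqP.
  by rewrite eqr_nat eqSS => /eqP.
by rewrite size_map size_iota ltnn.
Qed.

Lemma D_eq_homW (R : realType) n : D R n = homW R n.
Proof.
by apply: poly_eq_off0 => x x0; rewrite horner_D_chebW // horner_homW.
Qed.

(** The left-hand side of the functional equation is the evaluation at x of the
polynomial with reversed coefficients. *)
Lemma self_reciprocal (R : numFieldType) (p : {poly R}) d :
  (size p <= d.+1)%N ->
  (forall x, x != 0 -> x ^+ d * p.[x^-1] = p.[x]) ->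
  forall k, (k <= d)%N -> p`_k = p`_(d - k).
Proof.
move=> sp px k lekd.
suff rev : p = \poly_(i < d.+1) p`_(d - i).
  by rewrite [in LHS]rev coef_poly ltnS lekd.
apply: poly_eq_off0 => x x0; rewrite -px // (horner_coef_wide _ sp).
rewrite horner_poly mulr_sumr (reindex_inj rev_ord_inj) /=.
apply: eq_bigr => i _; rewrite subSS mulrCA; congr (_ * _).
have le_id : (i <= d)%N by rewrite -ltnS.
rewrite exprVn -[in X in X / _](subnK le_id) exprD mulrAC.
by rewrite divff ?mul1r ?expf_neq0.
Qed.

Theorem theorem4p3 (R : realType) (n : nat) :
  [/\ D R n = \sum_(0 <= k < (2 * n).+1) a R n k *: 'X^k,
      (forall k : nat, (k <= 2 * n)%N -> a R n k = a R n (2 * n - k)%N),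
      (forall k : nat, (k <= n)%N -> a R n k = (B n k + B_pred n k)%:R)
    & (forall k : nat, (n < k <= 2 * n)%N -> a R n k = a R n (2 * n - k)%N)].
Proof.
have sym k : (k <= 2 * n)%N -> a R n k = a R n (2 * n - k)%N.
  by apply: self_reciprocal (size_D R n) _ k => x; apply: horner_D_inv.
split=> // [|k le_kn|k /andP[_]]; last exact: sym.
  rewrite big_mkord -poly_def; apply/polyP => k; rewrite coef_poly.
  case: ltnP => // le_k; rewrite nth_default //.
  exact: leq_trans (size_D R n) le_k.
by rewrite /a D_eq_homW coef_homW.
Qed.
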